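(* Let $A$ be an $n\times n$ (real symmetric) positive definite matrix and $b\in\mathbb{R}^n$. Let $x_*\in\mathbb{R}^n$ denote the unique vector satisfying $Ax_*=b$. Suppose each $S_k$, $k=0,1,2,\dots$, is an independent copy of a random matrix $S\in\mathbb{R}^{n\times p}$. Put $\mu=\lambda_{\min}(\mathbb{E}[P_{A^{1/2}S}])$ and suppose the distribution of $S$ satisfies $\mu>0$. Let $H=S(S^{T}AS)^{\dagger}S^{T}$, $G=\mathbb{E}[H]$, and $$\nu=\lambda_{\max}\left(\mathbb{E}\left[(G^{-1/2}HG^{-1/2})^2\right]\right),\qquad \tau=\sqrt{\mu/\nu}.$$ Let $x_0\in\mathbb{R}^n$, $y_0=z_0=x_0$, and for $k\ge 0$, with $H_k=S_k(S_k^{T}AS_k)^{\dagger}S_k^{T}$, define $$x_{k+1}=\tfrac{1}{1+\tau}y_k+\tfrac{\tau}{1+\tau}z_k,$$ $$y_{k+1}=x_{k+1}-H_k(Ax_{k+1}-b),$$ $$z_{k+1}=z_k+\tau(x_{k+1}-z_k)-\tfrac{\tau}{\mu}H_k(Ax_{k+1}-b).$$ Then for all $k\geq 0$, $$\mathbb{E}[\|y_k-x_*\|_A]\leq\sqrt2\,(1-\tau)^{k/2}\|x_0-x_*\|_A.$$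
   Context: For a matrix $M$, $M^{\dagger}$ is the Moore-Penrose pseudo-inverse and $P_M$ the orthogonal projector onto the range of $M$; for positive semi-definite $M$, $M^{1/2}$ is its positive semi-definite square root; $\lambda_{\min},\lambda_{\max}$ denote smallest and largest eigenvalues. For positive definite $M$, $\|x\|_M=\sqrt{x^{T}Mx}$. (The condition $\mu>0$ is equivalent to $G$ being positive definite, so $G^{-1/2}$ makes sense.) The recursion is the accelerated randomized block Gauss-Seidel algorithm. *)

(* Defs.v *)
From HB Require Import structures.
From mathcomp Require Import all_boot all_order all_algebra.
From mathcomp Require Import all_classical all_reals all_analysis.
Import Order.TTheory GRing.Theory Num.Theory.
Import numFieldNormedType.Exports.

Set Implicit Arguments.
Unset Strict Implicit.
Unset Printing Implicit Defensive.

Local Open Scope classical_set_scope.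
Local Open Scope ring_scope.

Section Matrices.
Context {R : realType}.

Definition quadform n (M : 'M[R]_n) (v : 'cV[R]_n) : R :=
  (v^T *m M *m v) 0 0.

Definition posdefmx n (M : 'M[R]_n) : Prop :=
  M^T = M /\ forall v : 'cV[R]_n, v != 0 -> 0 < quadform M v.

Definition possemidefmx n (M : 'M[R]_n) : Prop :=
  M^T = M /\ forall v : 'cV[R]_n, 0 <= quadform M v.

Definition norm_mx n (M : 'M[R]_n) (v : 'cV[R]_n) : R :=
  Num.sqrt (quadform M v).

(* The four Penrose equations; they have exactly one solution.  The library's
   pinvmx is a generalized inverse that need not satisfy the last two. *)
Definition is_MPinverse m n (M : 'M[R]_(m, n)) (X : 'M[R]_(n, m)) : Prop :=
  [/\ M *m X *m M = M, X *m M *m X = X,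
      (M *m X)^T = M *m X & (X *m M)^T = X *m M].

Definition MPinverse m n (M : 'M[R]_(m, n)) : 'M[R]_(n, m) :=
  get [set X | is_MPinverse M X].

(* %MS compares row spaces, so the range (column space) of M is the row space
   of M^T. *)
Definition is_range_proj m n (M : 'M[R]_(m, n)) (Q : 'M[R]_m) : Prop :=
  [/\ Q^T = Q, Q *m Q = Q & (Q^T :=: M^T)%MS].

Definition range_proj m n (M : 'M[R]_(m, n)) : 'M[R]_m :=
  get [set Q | is_range_proj M Q].

(* Meaningful for M positive semi-definite, where X exists and is unique. *)
Definition sqrt_mx n (M : 'M[R]_n) : 'M[R]_n :=
  get [set X | possemidefmx X /\ X *m X = M].

(* Used on symmetric matrices only, for which the set of eigenvalues is finite,
   and nonempty if n > 0, so that inf and sup are attained.  For n = 0 the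
   value is 0. *)
Definition lambda_min n (M : 'M[R]_n) : R := inf [set a | eigenvalue M a].
Definition lambda_max n (M : 'M[R]_n) : R := sup [set a | eigenvalue M a].

End Matrices.

(* The type of n x p real matrices, with the Borel sigma-algebra. *)
Notation borelMx R n p := (g_sigma_algebraType (@open 'M[R]_(n, p))).

Section Probability.
Context {R : realType} {d : measure_display} {T : measurableType d}.
Variable P : probability T R.

Definition expectation_mx m n (M : T -> 'M[R]_(m, n)) : 'M[R]_(m, n) :=
  \matrix_(i, j) fine ('E_P[fun w => M w i j])%E.

Definition same_law d' (T' : measurableType d') (X Y : {RV P >-> T'}) : Prop :=
  forall B : set T', measurable B -> distribution P X B = distribution P Y B.

Definition mutually_independent d' (T' : measurableType d')
    (X : nat -> {RV P >-> T'}) : Prop :=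
  forall (J : seq nat) (B : nat -> set T'),
    uniq J -> (forall i, measurable (B i)) ->
    P (\bigcap_(i in [set` J]) (X i @^-1` B i)) =
    (\prod_(i <- J) P (X i @^-1` B i))%E.

End Probability.

Section GaussSeidel.
Context {R : realType} {n p : nat}.
Variable A : 'M[R]_n.

Definition gs_H (S : 'M[R]_(n, p)) : 'M[R]_n :=
  S *m MPinverse (S^T *m A *m S) *m S^T.

Context {d : measure_display} {T : measurableType d}.
Variables (P : probability T R) (S : T -> 'M[R]_(n, p)).

Definition gs_mu : R :=
  lambda_min (expectation_mx P (fun w => range_proj (sqrt_mx A *m S w))).

Definition gs_G : 'M[R]_n := expectation_mx P (fun w => gs_H (S w)).

Definition gs_nu : R :=
  let W := invmx (sqrt_mx gs_G) in
  lambda_max (expectation_mx P (fun w =>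
    let K := W *m gs_H (S w) *m W in K *m K)).

Definition gs_tau : R := Num.sqrt (gs_mu / gs_nu).

End GaussSeidel.

(* Main.v *)
Require Import Defs.
From HB Require Import structures.
From mathcomp Require Import all_boot all_order all_algebra.
From mathcomp Require Import finmap.
From mathcomp Require Import all_classical all_reals all_analysis.
From mathcomp Require Import measurable_realfun.
From mathcomp Require Import ring lra.
Import Order.TTheory GRing.Theory Num.Theory.
Import numFieldNormedType.Exports.

Set Implicit Arguments.
Unset Strict Implicit.
Unset Printing Implicit Defensive.

Local Open Scope classical_set_scope.
Local Open Scope ring_scope.

(** The errors e_y = y_k - x_* and e_z = z_k - x_* stacked in one vector s_k
    obey a random linear recursion s_(k+1) = F(S_k) s_k. The proof exhibits a
    quadratic Lyapunov function that contracts in mean by the factor 1 - tau,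
       V(e_y, e_z) = |e_y|_A^2 + mu |e_z|_(G^-1)^2 .

    For a fixed state ([one_step]) put e_x = x_(k+1) - x_*, g = A e_x and
    u = (1 - tau) e_z + tau e_x. As H A H = H, the new errors satisfy
       |e_y'|_A^2 = |e_x|_A^2 - g^T H g,
       mu |e_z'|_(G^-1)^2 = mu |u|_(G^-1)^2 - 2 tau u^T G^-1 H g
                            + (tau^2 / mu) g^T H G^-1 H g.
    In the mean, G^-1 H becomes the identity, and E[H G^-1 H] <= nu G by the
    definition of nu, so the choice tau^2 nu = mu makes the two terms of size
    g^T G g cancel. What is left is estimated by convexity of |.|_(G^-1)^2, by
    mu G^-1 <= A (which is E[P_(A^(1/2) S)] >= mu rewritten, [mu_inv_G_le]), by
    the identity tau u = e_x - (1 - tau) e_y and by |e_x - e_y|_A^2 >= 0.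
    That 0 <= tau <= 1 follows from mu <= 1 (a mean of projectors) and from
    nu >= 1 (the mean of K = G^(-1/2) H G^(-1/2) is the identity).

    To iterate ([lyapunov_decay]) the state s_k must be independent of S_k. It is
    enough to know this for the products of two entries of s_k, which are sums
    of products f_0(S_0) ... f_(k-1)(S_(k-1)); the class [past] contains these
    and is stable under the recursion by construction. Since V(s_0) <= 2 |x_0 - x_*|_A^2, this bounds
    E|e_y|_A^2, and E|e_y|_A is at most its square root ([mean_le_of_sqr]).

    Everything is stated with the projector, the pseudo-inverse and the square
    root that the definitions pick by choice, so their existence has
    to be established: the range projector by Gram-Schmidt, in a form that also shows that
    it is a Borel function of the matrix ([col_proj]); the pseudo-inverse from
    the range projector and any generalized inverse ([MPinverse_symP]); the
    square root by deflation ([psd_sqrt_exists]), starting from the fact that the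
    maximum of a Rayleigh quotient is an eigenvalue ([max_rayleigh]). *)

(** * Euclidean scalar product and quadratic forms *)

Section DotProduct.
Context {R : realType}.

Definition dotv n (u v : 'cV[R]_n) : R := (u^T *m v) 0 0.

Lemma dotvE n (u v : 'cV[R]_n) : dotv u v = \sum_i u i 0 * v i 0.
Proof. by rewrite /dotv !mxE; apply: eq_bigr => i _; rewrite !mxE. Qed.

Lemma dotvC n (u v : 'cV[R]_n) : dotv u v = dotv v u.
Proof. by rewrite !dotvE; apply: eq_bigr => i _; rewrite mulrC. Qed.

Lemma dotvDr n (u v w : 'cV[R]_n) : dotv u (v + w) = dotv u v + dotv u w.
Proof. by rewrite /dotv mulmxDr mxE. Qed.

Lemma dotvDl n (u v w : 'cV[R]_n) : dotv (u + v) w = dotv u w + dotv v w.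
Proof. by rewrite dotvC dotvDr !(dotvC w). Qed.

Lemma dotvZr n a (u v : 'cV[R]_n) : dotv u (a *: v) = a * dotv u v.
Proof. by rewrite /dotv -scalemxAr mxE. Qed.

Lemma dotvZl n a (u v : 'cV[R]_n) : dotv (a *: u) v = a * dotv u v.
Proof. by rewrite dotvC dotvZr dotvC. Qed.

Lemma dotvNr n (u v : 'cV[R]_n) : dotv u (- v) = - dotv u v.
Proof. by rewrite -scaleN1r dotvZr mulN1r. Qed.

Lemma dotvNl n (u v : 'cV[R]_n) : dotv (- u) v = - dotv u v.
Proof. by rewrite dotvC dotvNr dotvC. Qed.

Lemma dotv0r n (u : 'cV[R]_n) : dotv u 0 = 0.
Proof. by rewrite /dotv mulmx0 mxE. Qed.

Definition dotv_lin := (dotvDl, dotvDr, dotvZl, dotvZr, dotvNl, dotvNr).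

Lemma dotv_mulmxl m n (M : 'M[R]_(m, n)) u v :
  dotv (M *m u) v = dotv u (M^T *m v).
Proof. by rewrite /dotv trmx_mul mulmxA. Qed.

Lemma dotv_ge0 n (u : 'cV[R]_n) : 0 <= dotv u u.
Proof. by rewrite dotvE; apply: sumr_ge0 => i _; rewrite -expr2 sqr_ge0. Qed.

Lemma dotv_eq0 n (u : 'cV[R]_n) : dotv u u = 0 -> u = 0.
Proof.
rewrite dotvE => /eqP; rewrite psumr_eq0 => [/allP u0|i _]; last first.
  by rewrite -expr2 sqr_ge0.
apply/matrixP => i j; rewrite (ord1 j) mxE; apply/eqP.
by have := u0 i; rewrite mem_index_enum mulf_eq0 orbb => /(_ isT).
Qed.

Lemma dotv_gt0 n (u : 'cV[R]_n) : u != 0 -> 0 < dotv u u.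
Proof.
by move=> u0; rewrite lt_def dotv_ge0 andbT; apply: contraNneq u0 => /dotv_eq0 ->.
Qed.

Lemma quadformE n (M : 'M[R]_n) v : quadform M v = dotv v (M *m v).
Proof. by rewrite /quadform /dotv mulmxA. Qed.

Lemma quadform_sum n (M : 'M[R]_n) v :
  quadform M v = \sum_i \sum_j M i j * (v i 0 * v j 0).
Proof.
rewrite quadformE dotvE; apply: eq_bigr => i _.
by rewrite mxE mulr_sumr; apply: eq_bigr => j _; ring.
Qed.

Lemma mulmx_outer n (u v w : 'cV[R]_n) : u *m v^T *m w = dotv v w *: u.
Proof.
by rewrite -mulmxA [v^T *m w]mx11_scalar mul_mx_scalar.
Qed.

Lemma symmx_dotv n (M : 'M[R]_n) u v : M^T = M ->
  dotv (M *m u) v = dotv u (M *m v).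
Proof. by move=> sM; rewrite dotv_mulmxl sM. Qed.

(** The form at v + t w with w = M v is 2 t |w|^2 + O(t^2), which would be negative
    for small t < 0 if w were nonzero. *)
Lemma psd_quadform_eq0 n (M : 'M[R]_n) v :
  possemidefmx M -> quadform M v = 0 -> M *m v = 0.
Proof.
move=> [sM pM]; rewrite quadformE => v0.
pose w := M *m v; set a := dotv w w; have a0 : 0 <= a := dotv_ge0 w.
set c := dotv w (M *m w); have c0 : 0 <= c by rewrite /c -quadformE.
have pt t : 0 <= 2 * t * a + t ^+ 2 * c.
  have := pM (v + t *: w); rewrite quadformE !mulmxDr -scalemxAr !dotv_lin.
  by rewrite v0 -(symmx_dotv v w sM) -/w -/c -/a => /le_trans; apply; lra.
clear -a0 c0 pt; apply: dotv_eq0; rewrite -/a; move: a c a0 c0 pt => a c.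
(* For c = 0 the minimiser t = - a / c does not exist, hence c + 1. *)
rewrite le_eqVlt => /predU1P[//|a0] c0 /(_ (- (a / (c + 1)))).
have -> : 2 * - (a / (c + 1)) * a + (- (a / (c + 1))) ^+ 2 * c =
   - (a ^+ 2 * (c + 2) / (c + 1) ^+ 2) by field; lra.
by rewrite oppr_ge0 leNgt divr_gt0// ?mulr_gt0// ?exprn_gt0//; lra.
Qed.

End DotProduct.

(** * Extremal eigenvalues of symmetric matrices *)

Section SpectralTheory.
Context {R : realType}.

Lemma bounded_unit_sphere n : bounded_set [set u : 'rV[R]_n | dotv u^T u^T = 1].
Proof.
exists 1; split; first exact: num_real.
move=> M M1 u /= u1; apply/ltW; apply: le_lt_trans M1.
rewrite [leLHS]/Num.norm /= mx_normrE; apply: bigmax_le => // -[i j] _ /=.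
rewrite (ord1 i) -(@ler_pXn2r _ 2) ?nnegrE ?expr1n// real_normK ?num_real//.
rewrite -u1 dotvE (bigD1 j)//= !mxE expr2 lerDl sumr_ge0// => k _.
by rewrite mxE -expr2 sqr_ge0.
Qed.

Lemma continuous_quadform n (M : 'M[R]_n) :
  continuous (fun u : 'rV[R]_n => quadform M u^T).
Proof.
have -> : (fun u : 'rV[R]_n => quadform M u^T) =
    (fun u => \sum_i \sum_j M i j * (u 0 i * u 0 j)).
  apply/funext => u; rewrite quadform_sum; apply: eq_bigr => i _.
  by apply: eq_bigr => j _; rewrite !mxE.
apply: continuous_big => [|i _]; first exact: add_continuous.
apply: continuous_big => [|j _ u]; first exact: add_continuous.
apply: (@continuousM _ _ (fun=> M i j) (fun u : 'rV[R]_n => u 0 i * u 0 j)).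
  exact: cst_continuous.
by apply: continuousM; exact: (@coord_continuous R _ _ 0).
Qed.

(** Rayleigh: the maximum of the quadratic form on the unit sphere is attained,
    and at a maximiser v the form lam |x|^2 - x^T M x is nonnegative and vanishes,
    which makes v an eigenvector. *)
Lemma max_rayleigh n (M : 'M[R]_n) : (0 < n)%N -> M^T = M ->
  exists v lam, [/\ dotv v v = 1, M *m v = lam *: v &
    forall x, quadform M x <= lam * dotv x x].
Proof.
move=> n0 sM; pose A := [set u : 'rV[R]_n | dotv u^T u^T = 1].
have A0 : A !=set0.
  exists (delta_mx 0 (Ordinal n0)); rewrite /A /= dotvE (bigD1 (Ordinal n0))//=.
  rewrite !mxE !eqxx mulr1 big1 ?addr0// => i ni.
  by rewrite !mxE (negbTE ni) andbF mulr0.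
have Aq u : A u <-> quadform 1%:M u^T = 1 by rewrite quadformE mul1mx.
have cA : compact A.
  apply: bounded_closed_compact; first exact: bounded_unit_sphere.
  rewrite (_ : A = (fun u : 'rV[R]_n => quadform 1%:M u^T) @^-1` [set 1]).
    apply: preimage_closed; last exact: closed_eq.
    by move=> u _; exact: continuous_quadform.
  by apply/seteqP; split=> u /Aq.
have [|v vA vmax] := EVT_max_rV A0 cA (f := fun u => quadform M u^T).
  exact/continuous_subspaceT/continuous_quadform.
rewrite inE in vA; pose lam := quadform M v^T.
have le x : quadform M x <= lam * dotv x x.
  have [->|x0] := eqVneq x 0; first by rewrite quadformE mulmx0 !dotv0r mulr0.
  have xx := dotv_gt0 x0; pose t := Num.sqrt (dotv x x).
  have t0 : 0 < t by rewrite sqrtr_gt0.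
  have tt : t * t = dotv x x by rewrite -expr2 sqr_sqrtr// ltW.
  have /vmax : (t^-1 *: x)^T \in A.
    by rewrite inE /A /= trmxK !dotv_lin -tt; field; rewrite gt_eqF.
  rewrite trmxK -/lam !quadformE -scalemxAr !dotv_lin mulrA -invfM.
  by rewrite tt mulrC ler_pdivrMr.
exists v^T, lam; split=> //.
have psd : possemidefmx (lam%:M - M).
  split; first by rewrite linearB /= tr_scalar_mx sM.
  move=> x; rewrite quadformE mulmxBl mul_scalar_mx !dotv_lin -quadformE subr_ge0.
  exact: le.
have /(psd_quadform_eq0 psd) : quadform (lam%:M - M) v^T = 0.
  rewrite quadformE mulmxBl mul_scalar_mx !dotv_lin -quadformE vA mulr1.
  exact: subrr.
by rewrite mulmxBl mul_scalar_mx => /eqP; rewrite subr_eq0 => /eqP ->.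
Qed.

Lemma min_rayleigh n (M : 'M[R]_n) : (0 < n)%N -> M^T = M ->
  exists v lam, [/\ dotv v v = 1, M *m v = lam *: v &
    forall x, lam * dotv x x <= quadform M x].
Proof.
move=> n0 sM; have [|v [lam [v1 Mv le]]] := @max_rayleigh _ (- M) n0.
  by rewrite linearN /= sM.
exists v, (- lam); split=> //; first by rewrite scaleNr -Mv mulNmx opprK.
move=> x; have := le x; rewrite !quadformE mulNmx !dotv_lin => xl.
by rewrite mulNr lerNl.
Qed.

Lemma eigenvalue_symP n (M : 'M[R]_n) a : M^T = M ->
  reflect (exists2 v : 'cV[R]_n, v != 0 & M *m v = a *: v) (eigenvalue M a).
Proof.
move=> sM; apply: (iffP eigenvalueP) => -[v].
  move=> vM v0; exists v^T; last by rewrite -{1}sM -trmx_mul vM linearZ.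
  by apply: contraNneq v0 => v0; rewrite -[v]trmxK v0 trmx0.
move=> v0 Mv; exists v^T; first by rewrite -{1}sM -trmx_mul Mv linearZ.
by apply: contraNneq v0 => v0; rewrite -[v]trmxK v0 trmx0.
Qed.

Lemma lambda_max_ge n (M : 'M[R]_n) x : M^T = M ->
  quadform M x <= lambda_max M * dotv x x.
Proof.
move=> sM; case: (posnP n) => [n0|n0].
  by rewrite quadformE !dotvE !big1 ?mulr0// => -[i i0]; exfalso; rewrite n0 in i0.
have [v [lam [v1 Mv le]]] := max_rayleigh n0 sM.
have lamE : eigenvalue M lam.
  apply/eigenvalue_symP => //; exists v => //.
  by apply: contra_eq_neq v1 => ->; rewrite dotv0r eq_sym oner_eq0.
rewrite (le_trans (le x))// ler_wpM2r ?dotv_ge0//.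
apply: sup_upper_bound => //; split; first by exists lam.
exists lam => a /(eigenvalue_symP _ sM)[w w0 Mw].
by have := le w; rewrite quadformE Mw !dotv_lin ler_pM2r// dotv_gt0.
Qed.

Lemma lambda_min_le n (M : 'M[R]_n) x : M^T = M ->
  lambda_min M * dotv x x <= quadform M x.
Proof.
move=> sM; case: (posnP n) => [n0|n0].
  by rewrite quadformE !dotvE !big1 ?mulr0// => -[i i0]; exfalso; rewrite n0 in i0.
have [v [lam [v1 Mv le]]] := min_rayleigh n0 sM.
have lamE : eigenvalue M lam.
  apply/eigenvalue_symP => //; exists v => //.
  by apply: contra_eq_neq v1 => ->; rewrite dotv0r eq_sym oner_eq0.
rewrite (le_trans _ (le x))// ler_wpM2r ?dotv_ge0//.
apply: inf_lbound => //; exists lam => a /(eigenvalue_symP _ sM)[w w0 Mw].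
by have := le w; rewrite quadformE Mw !dotv_lin ler_pM2r// dotv_gt0.
Qed.

(** The set of eigenvalues is empty, and the infimum of the empty set is 0; this is
    how mu > 0 forces n > 0. *)
Lemma lambda_min_dim0 (M : 'M[R]_0) : lambda_min M = 0.
Proof.
rewrite /lambda_min (_ : [set _ | _] = set0) ?inf0//.
apply/seteqP; split=> // a /eigenvalueP[v _ /negP]; apply.
by apply/eqP/matrixP => i [].
Qed.

End SpectralTheory.

(** * Range projectors and pseudo-inverses *)

Section OrthogonalProjectors.
Context {R : realType}.

(** Inclusion of row spaces is a factorization; once Q is idempotent, M = Q Y for some Y
    amounts to Q M = M. *)
Lemma is_range_projP m n (M : 'M[R]_(m, n)) (Q : 'M[R]_m) :
  is_range_proj M Q <->
  [/\ Q^T = Q, Q *m Q = Q, Q *m M = M & exists Y, Q = M *m Y].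
Proof.
split=> [[sQ iQ QM]|[sQ iQ QM [Y QE]]]; split=> //.
- have /submxP[D MD] : (M^T <= Q^T)%MS by rewrite QM.
  by rewrite -[M]trmxK MD trmx_mul trmxK mulmxA iQ.
- have /submxP[D QD] : (Q^T <= M^T)%MS by rewrite QM.
  by exists D^T; rewrite -[Q]trmxK QD trmx_mul trmxK.
- apply/eqmxP/andP; split; apply/submxP; last by exists M^T; rewrite -trmx_mul QM.
  by exists Y^T; rewrite -trmx_mul -QE.
Qed.

Lemma is_range_proj_uniq m n (M : 'M[R]_(m, n)) Q Q' :
  is_range_proj M Q -> is_range_proj M Q' -> Q = Q'.
Proof.
move=> /is_range_projP[sQ _ QM [Y QE]] /is_range_projP[sQ' _ QM' [Y' QE']].
have QQ' : Q *m Q' = Q' by rewrite QE' mulmxA QM.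
by rewrite -QQ' -sQ -sQ' -trmx_mul [in RHS]QE mulmxA QM' -QE.
Qed.

(** Gram-Schmidt on the columns listed in s: the part v of a new column orthogonal to
    the previous ones contributes v v^T / |v|^2. If v = 0 the inverse of 0 is 0 and
    the projector does not change, so no case distinction on the rank is needed. *)
Fixpoint col_proj m n (M : 'M[R]_(m, n)) (s : seq 'I_n) : 'M[R]_m :=
  if s is j :: s' then
    let Q := col_proj M s' in let v := col j M - Q *m col j M in
    Q + (dotv v v)^-1 *: (v *m v^T)
  else 0.

Lemma col_projP m n (M : 'M[R]_(m, n)) s : let Q := col_proj M s in
  [/\ Q^T = Q, Q *m Q = Q, {in s, forall j, Q *m col j M = col j M} &
      exists Y, Q = M *m Y].
Proof.
elim: s => [|j s] /=.
  by split; rewrite ?trmx0 ?mul0mx//; exists 0; rewrite mulmx0.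
set Q := col_proj M s => -[sQ iQ Qcol [Y QE]].
set c := col j M; have [v vE] : {v | v = c - Q *m c} by exists (c - Q *m c).
rewrite -vE; set a := _^-1; have Qv : Q *m v = 0 by rewrite vE mulmxBr mulmxA iQ subrr.
have vQ : v^T *m Q = 0 by rewrite -{1}sQ -trmx_mul Qv trmx0.
have av : (a * dotv v v) *: v = v.
  have [->|v0] := eqVneq v 0; first by rewrite scaler0.
  by rewrite mulVf ?scale1r// gt_eqF// dotv_gt0.
split.
- by rewrite linearD linearZ /= trmx_mul trmxK sQ.
- have QW : Q *m (v *m v^T) = 0 by rewrite mulmxA Qv mul0mx.
  have WQ : v *m v^T *m Q = 0 by rewrite -mulmxA vQ mulmx0.
  have WW : v *m v^T *m (a *: (v *m v^T)) = v *m v^T.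
    by rewrite -scalemxAr mulmxA mulmx_outer -scalemxAl scalerA scalemxAl av.
  rewrite mulmxDr !mulmxDl -(scalemxAr a Q) -!scalemxAl iQ QW WQ WW !scaler0.
  by rewrite addr0 add0r.
- move=> k; rewrite inE mulmxDl -scalemxAl mulmx_outer => /predU1P[->|ks].
    have -> : dotv v (col j M) = dotv v v.
      rewrite -/c -[X in dotv v X](subrK (Q *m c)) -vE dotvDr.
      by rewrite -(symmx_dotv _ _ sQ) Qv dotvC dotv0r addr0.
    by rewrite -/c scalerA av vE addrC subrK.
  rewrite -[in dotv _ _](Qcol k ks) -(symmx_dotv _ _ sQ) Qv dotvC dotv0r.
  by rewrite scale0r scaler0 addr0 Qcol.
- exists (Y + a *: ((delta_mx j 0 - Y *m c) *m v^T)).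
  by rewrite mulmxDr -QE -scalemxAr mulmxA mulmxBr -colE mulmxA -QE vE.
Qed.

Lemma col_proj_range m n (M : 'M[R]_(m, n)) :
  is_range_proj M (col_proj M (enum 'I_n)).
Proof.
apply/is_range_projP; have [sQ iQ Qcol QE] := col_projP M (enum 'I_n).
split=> //; apply/matrixP => i j.
by have /matrixP/(_ i 0) := Qcol j (mem_enum _ j); rewrite colE mulmxA -!colE !mxE.
Qed.

Lemma range_projE m n (M : 'M[R]_(m, n)) :
  range_proj M = col_proj M (enum 'I_n).
Proof.
apply: (is_range_proj_uniq _ (col_proj_range M)).
exact: (@getI _ [set Q | is_range_proj M Q] _ (col_proj_range M)).
Qed.

Lemma range_projP m n (M : 'M[R]_(m, n)) : is_range_proj M (range_proj M).
Proof. by rewrite range_projE; exact: col_proj_range. Qed.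

(** The diagonal entry Q_ii = sum_l Q_il^2 dominates both its own square, hence is at
    most 1, and the squares of all entries of its row. *)
Lemma proj_entry_le1 n (Q : 'M[R]_n) i j :
  Q^T = Q -> Q *m Q = Q -> `|Q i j| <= 1.
Proof.
move=> sQ iQ.
have Qii k : Q k k = \sum_l Q k l ^+ 2.
  rewrite -{1}iQ mxE; apply: eq_bigr => l _.
  by rewrite expr2 -{2}sQ mxE.
have le k l : Q k l ^+ 2 <= Q k k.
  by rewrite Qii (bigD1 l)//= lerDl sumr_ge0// => ? _; rewrite sqr_ge0.
have Q1 : Q i i <= 1.
  have := le i i; case: (ltrP 0 (Q i i)) => [Qp|/le_trans Qn _]; last exact/Qn/ler01.
  by rewrite expr2 ger_pMr.
by rewrite -(@ler_pXn2r _ 2) ?nnegrE// expr1n real_normK ?num_real// (le_trans (le i j)).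
Qed.

Lemma mulTmx_eq0 m n (C : 'M[R]_(m, n)) : C^T *m C = 0 -> C = 0.
Proof.
move=> CC; apply/matrixP => i j; have /dotv_eq0/matrixP/(_ i 0) :
    dotv (col j C) (col j C) = 0.
  rewrite dotvE; have /matrixP/(_ j j) := CC; rewrite !mxE => {2}<-.
  by apply: eq_bigr => k _; rewrite !mxE.
by rewrite !mxE.
Qed.

Lemma proj_quadform_le n (Q : 'M[R]_n) v :
  Q^T = Q -> Q *m Q = Q -> quadform Q v <= dotv v v.
Proof.
move=> sQ iQ; have := dotv_ge0 (v - Q *m v).
rewrite !dotv_lin -quadformE symmx_dotv// -quadformE symmx_dotv// mulmxA iQ.
rewrite -quadformE; lra.
Qed.

Lemma is_MPinverse_uniq m n (M : 'M[R]_(m, n)) X Y :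
  is_MPinverse M X -> is_MPinverse M Y -> X = Y.
Proof.
move=> [MXM XMX sMX sXM] [MYM YMY sMY sYM].
have MXY : M *m X = M *m Y.
  by rewrite -sMX -{1}MYM -mulmxA trmx_mul sMX sMY mulmxA MXM.
have XYM : X *m M = Y *m M.
  have e : X *m M *m (Y *m M) = X *m M by rewrite -mulmxA (mulmxA M) MYM.
  by rewrite -sXM -e trmx_mul sXM sYM -mulmxA (mulmxA M) MXM.
by rewrite -XMX XYM -mulmxA MXY mulmxA YMY.
Qed.

(** For symmetric M with range projector Q, sandwiching any generalized inverse g
    between two copies of Q yields the two missing symmetry equations, because then
    both M X and X M equal Q. *)
Lemma MPinverse_symP n (M : 'M[R]_n) : M^T = M -> is_MPinverse M (MPinverse M).
Proof.
move=> sM; have /is_range_projP[] := range_projP M.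
set Q := range_proj M => sQ iQ QM [Y QE].
have MQ : M *m Q = M by rewrite -sM -sQ -trmx_mul QM.
have [g MgM] : {g | M *m g *m M = M} by exists (pinvmx M); exact: mulmxKpV.
have QE' : Q = Y^T *m M by rewrite -sQ QE trmx_mul sM.
have MX : M *m (Q *m g *m Q) = Q.
  by rewrite !mulmxA MQ QE mulmxA MgM.
have XM : Q *m g *m Q *m M = Q.
  by rewrite -mulmxA QM QE' -!mulmxA (mulmxA M) MgM.
apply: (@getI _ [set X | is_MPinverse M X] (Q *m g *m Q)).
by split; rewrite ?MX ?XM ?QM//; rewrite !mulmxA iQ.
Qed.

Lemma trmx_MPinverse n (M : 'M[R]_n) :
  M^T = M -> (MPinverse M)^T = MPinverse M.
Proof.
move=> sM; have X := MPinverse_symP sM; apply: (is_MPinverse_uniq _ X).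
case: X => e1 e2 e3 e4.
have t4 : M *m (MPinverse M)^T = MPinverse M *m M by rewrite -e4 trmx_mul sM.
have t3 : (MPinverse M)^T *m M = M *m MPinverse M by rewrite -e3 trmx_mul sM.
split; rewrite ?t3 ?t4 ?e3 ?e4//; apply: trmx_inj.
  by rewrite trmx_mul e4 sM mulmxA e1.
by rewrite trmx_mul trmxK e3 mulmxA e2.
Qed.

(** The classical formula N (N^T N)^+ N^T for the orthogonal projector. *)
Lemma gram_range_proj m n (N : 'M[R]_(m, n)) :
  is_range_proj N (N *m MPinverse (N^T *m N) *m N^T).
Proof.
have sM : (N^T *m N)^T = N^T *m N by rewrite trmx_mul trmxK.
have [MXM XMX _ sXM] := MPinverse_symP sM; have := trmx_MPinverse sM.
move: (MPinverse _) MXM XMX sXM => X MXM XMX sXM sX.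
have NC : N^T *m (N *m (X *m (N^T *m N)) - N) = 0.
  by rewrite mulmxBr -[X in _ - X]MXM !mulmxA subrr.
have QN : N *m X *m N^T *m N = N.
  rewrite -!mulmxA; apply/eqP; rewrite -subr_eq0; apply/eqP.
  apply: mulTmx_eq0; rewrite [(_ - _)^T]linearB /= [(N *m _)^T]trmx_mul mulmxBl.
  by rewrite -mulmxA NC mulmx0 subrr.
apply/is_range_projP; split=> //.
- by rewrite !trmx_mul trmxK sX mulmxA.
- by rewrite !mulmxA QN.
- by exists (X *m N^T); rewrite mulmxA.
Qed.

End OrthogonalProjectors.

(** * Square roots of positive semi-definite matrices *)

Section SquareRoot.
Context {R : realType}.

(** Deflation: if v is a unit eigenvector for the largest eigenvalue lam, then
    M - lam v v^T is positive semi-definite of smaller rank and kills v; so does its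
    square root X, and X + sqrt(lam) v v^T is a square root of M. *)
Lemma psd_sqrt_exists n (M : 'M[R]_n) : possemidefmx M ->
  exists X, possemidefmx X /\ X *m X = M.
Proof.
have [r] := ubnP (\rank M); elim: r M => // r IHr M rM psdM.
have [->|M0] := eqVneq M 0.
  exists 0; split; last by rewrite mulmx0.
  by split=> [|v]; rewrite ?trmx0// quadformE mul0mx dotv0r.
have n0 : (0 < n)%N.
  rewrite lt0n; apply: contraNneq M0 => n0; apply/eqP/matrixP => -[i i0].
  by exfalso; rewrite n0 in i0.
have [sM pM] := psdM; have [v [lam [v1 Mv le]]] := max_rayleigh n0 sM.
have lam0 : 0 < lam.
  rewrite ltNge; apply/negP => lam0; case/eqP: M0; apply/row_matrixP => i.
  rewrite row0 rowE -[delta_mx 0 i]trmxK -sM -trmx_mul.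
  rewrite psd_quadform_eq0 ?trmx0//; apply/eqP; rewrite eq_le pM andbT.
  by rewrite (le_trans (le _))// mulr_le0_ge0// dotv_ge0.
pose V := v *m v^T; have sV : V^T = V by rewrite /V trmx_mul trmxK.
have Vx x : V *m x = dotv v x *: v by rewrite mulmx_outer.
pose M' := M - lam *: V.
have sM' : M'^T = M' by rewrite linearB linearZ /= sM sV.
have M'v : M' *m v = 0.
  by rewrite mulmxBl Mv -scalemxAl Vx v1 scale1r subrr.
have [||X [[sX pX] XX]] := IHr M'.
- rewrite -ltnS (leq_trans _ rM)// ltnS rank_ltmx//; apply/andP; split.
    apply/submxP; exists (1%:M - V); rewrite mulmxBl mul1mx -mulmxA.
    by rewrite -{2}sM -trmx_mul Mv linearZ /= -scalemxAr.
  apply/negP => /submxP[D MD]; move: Mv v1; rewrite MD -mulmxA M'v mulmx0.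
  move/esym/eqP; rewrite scaler_eq0 gt_eqF//= => /eqP ->.
  by rewrite dotv0r => /esym/eqP; rewrite oner_eq0.
- split=> // x; have := pM (x - dotv v x *: v).
  rewrite !quadformE !(mulmxBr, mulmxBl) -!scalemxAr -scalemxAl Mv Vx !dotv_lin.
  by rewrite -(symmx_dotv v _ sM) Mv !dotv_lin v1 (dotvC x v); lra.
have Xv : X *m v = 0.
  apply: dotv_eq0; rewrite symmx_dotv// mulmxA XX M'v; exact: dotv0r.
exists (X + Num.sqrt lam *: V); split; [split|].
- by rewrite linearD linearZ /= sX sV.
- move=> x; rewrite quadformE mulmxDl -scalemxAl Vx !dotv_lin -quadformE.
  by rewrite addr_ge0// mulr_ge0 ?sqrtr_ge0// dotvC -expr2 sqr_ge0.
- have XV : X *m V = 0 by rewrite mulmxA Xv mul0mx.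
  have VX : V *m X = 0 by rewrite -sV -{1}sX -trmx_mul XV trmx0.
  have VV : V *m V = V by rewrite mulmxA Vx v1 scale1r.
  rewrite mulmxDr !mulmxDl XX -!scalemxAl -!scalemxAr XV VX VV !scaler0 add0r addr0.
  by rewrite scalerA -expr2 sqr_sqrtr ?subrK// ltW.
Qed.

Lemma sqrt_mxP n (M : 'M[R]_n) : possemidefmx M ->
  possemidefmx (sqrt_mx M) /\ sqrt_mx M *m sqrt_mx M = M.
Proof. by move=> /psd_sqrt_exists; exact: (@getPex _ [set X | _ /\ X *m X = M]). Qed.

Lemma posdef_psd n (M : 'M[R]_n) : posdefmx M -> possemidefmx M.
Proof.
move=> [sM pM]; split=> // v; have [->|/pM/ltW//] := eqVneq v 0.
by rewrite quadformE mulmx0 dotv0r.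
Qed.

Lemma posdef_unitmx n (M : 'M[R]_n) : posdefmx M -> M \in unitmx.
Proof.
move=> [sM pM]; rewrite -row_free_unit; apply: inj_row_free => v vM.
have Mv : M *m v^T = 0 by rewrite -{1}sM -trmx_mul vM trmx0.
apply/eqP; apply: contraT => v0; have /pM : v^T != 0.
  by apply: contraNneq v0 => v0; rewrite -[v]trmxK v0 trmx0.
by rewrite quadformE Mv dotv0r ltxx.
Qed.

Lemma sqrt_mx_unit n (M : 'M[R]_n) : posdefmx M -> sqrt_mx M \in unitmx.
Proof.
move=> pM; have [_ e] := sqrt_mxP (posdef_psd pM).
by have := posdef_unitmx pM; rewrite -{1}e unitmx_mul => /andP[].
Qed.

End SquareRoot.

Section ProjectorForm.
Context {R : realType} (n p : nat) (A : 'M[R]_n) (S : 'M[R]_(n, p)).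
Hypothesis pA : posdefmx A.

(** With B = A^(1/2), the matrix B H B is N (N^T N)^+ N^T for N = B S. *)
Lemma gs_H_proj :
  sqrt_mx A *m gs_H A S *m sqrt_mx A = range_proj (sqrt_mx A *m S).
Proof.
have [[sB _] BB] := sqrt_mxP (posdef_psd pA); set B := sqrt_mx A in sB BB *.
apply: (is_range_proj_uniq _ (range_projP _)); rewrite /gs_H.
have -> : S^T *m A *m S = (B *m S)^T *m (B *m S).
  by rewrite trmx_mul sB mulmxA -(mulmxA _ B B) BB.
suff <- : B *m S *m MPinverse ((B *m S)^T *m (B *m S)) *m (B *m S)^T =
    B *m (S *m MPinverse ((B *m S)^T *m (B *m S)) *m S^T) *m B.
  exact: gram_range_proj.
by rewrite [in X in _ *m X = _]trmx_mul sB !mulmxA.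
Qed.

Lemma gs_HAH : gs_H A S *m A *m gs_H A S = gs_H A S.
Proof.
have sM : (S^T *m A *m S)^T = S^T *m A *m S.
  by rewrite !trmx_mul trmxK (proj1 pA) mulmxA.
have [_ XMX _ _] := MPinverse_symP sM.
by rewrite /gs_H -[in RHS]XMX !mulmxA.
Qed.

Lemma trmx_gs_H : (gs_H A S)^T = gs_H A S.
Proof.
have sM : (S^T *m A *m S)^T = S^T *m A *m S.
  by rewrite !trmx_mul trmxK (proj1 pA) mulmxA.
by rewrite /gs_H !trmx_mul trmxK trmx_MPinverse// mulmxA.
Qed.

End ProjectorForm.

(** * Means of bounded random variables *)

Section BoundedMean.
Context {R : realType} {d : measure_display} {T : measurableType d}.
Implicit Types X Y : T -> R.

(** Sums, products and measurable substitutions preserve this class, and all its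
    members are integrable: integrability never has to be discussed again. *)
Definition bddmeas X : Prop :=
  measurable_fun setT X /\ exists C, forall w, `|X w| <= C.

Lemma bddmeas_cst a : bddmeas (fun=> a).
Proof. by split; [exact: measurable_cst|exists `|a|]. Qed.

Lemma bddmeasD X Y : bddmeas X -> bddmeas Y -> bddmeas (fun w => X w + Y w).
Proof.
move=> [mX [C XC]] [mY [D YD]]; split; first exact: measurable_funD.
by exists (C + D) => w; rewrite (le_trans (ler_normD _ _))// lerD.
Qed.

Lemma bddmeasM X Y : bddmeas X -> bddmeas Y -> bddmeas (fun w => X w * Y w).
Proof.
move=> [mX [C XC]] [mY [D YD]]; split; first exact: measurable_funM.
by exists (C * D) => w; rewrite normrM ler_pM.
Qed.

Lemma bddmeasZ a X : bddmeas X -> bddmeas (fun w => a * X w).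
Proof. exact/bddmeasM/bddmeas_cst. Qed.

Lemma bddmeas_sum (I : Type) (r : seq I) (X : I -> T -> R) :
  (forall i, bddmeas (X i)) -> bddmeas (fun w => \sum_(i <- r) X i w).
Proof.
move=> bX; elim: r => [|i r IHr].
  by under eq_fun do rewrite big_nil; exact: bddmeas_cst.
by under eq_fun do rewrite big_cons; exact: bddmeasD.
Qed.

Lemma bddmeas_prod (I : Type) (r : seq I) (X : I -> T -> R) :
  (forall i, bddmeas (X i)) -> bddmeas (fun w => \prod_(i <- r) X i w).
Proof.
move=> bX; elim: r => [|i r IHr].
  by under eq_fun do rewrite big_nil; exact: bddmeas_cst.
by under eq_fun do rewrite big_cons; exact: bddmeasM.
Qed.

Lemma bddmeas_indic (B : set T) : measurable B -> bddmeas \1_B.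
Proof.
move=> mB; split; first exact: measurable_indic.
by exists 1 => w; rewrite indicE normr_nat lern1 leq_b1.
Qed.

Variable P : probability T R.

Definition mean X : R := \int[P]_w X w.

Lemma fine_expectation X : fine 'E_P[X] = mean X.
Proof. by rewrite unlock. Qed.

Lemma bddmeas_integrable X : bddmeas X -> P.-integrable setT (EFin \o X).
Proof.
move=> [mX [C XC]]; apply: measurable_bounded_integrable => //.
  by rewrite -ge0_fin_numE ?fin_num_measure.
exists C; split; first exact: num_real.
by move=> M CM w _ /=; rewrite (le_trans (XC w))// ltW.
Qed.

Lemma expectation_mean X : bddmeas X -> 'E_P[X]%E = (mean X)%:E.
Proof.
move=> bX; rewrite unlock /mean /Rintegral fineK//.
exact: (integrable_fin_num _ (bddmeas_integrable bX)).
Qed.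

Lemma eq_mean X Y : X =1 Y -> mean X = mean Y.
Proof. by move=> /funext ->. Qed.

Lemma mean_cst a : mean (fun=> a) = a.
Proof. by rewrite -fine_expectation (expectation_cst P). Qed.

Lemma meanD X Y : bddmeas X -> bddmeas Y ->
  mean (fun w => X w + Y w) = mean X + mean Y.
Proof. by move=> bX bY; apply: RintegralD => //; exact: bddmeas_integrable. Qed.

Lemma meanZ a X : bddmeas X -> mean (fun w => a * X w) = a * mean X.
Proof. by move=> bX; apply: RintegralZl => //; exact: bddmeas_integrable. Qed.

Lemma mean_sum (I : Type) (r : seq I) (X : I -> T -> R) :
  (forall i, bddmeas (X i)) ->
  mean (fun w => \sum_(i <- r) X i w) = \sum_(i <- r) mean (X i).
Proof.
move=> bX; elim: r => [|i r IHr].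
  by rewrite big_nil -[RHS]mean_cst; apply: eq_mean => w; rewrite big_nil.
rewrite big_cons -IHr -meanD//; last exact: bddmeas_sum.
by apply: eq_mean => w; rewrite big_cons.
Qed.

Lemma le_mean X Y : bddmeas X -> bddmeas Y -> (forall w, X w <= Y w) ->
  mean X <= mean Y.
Proof.
by move=> bX bY XY; apply: le_Rintegral => //; exact: bddmeas_integrable.
Qed.

Lemma mean_indic (B : set T) : measurable B -> mean \1_B = fine (P B).
Proof. by move=> mB; rewrite -fine_expectation expectation_indic. Qed.

Lemma mean_cvg (X_ : nat -> T -> R) X C : (forall n, bddmeas (X_ n)) -> bddmeas X ->
  (forall n w, `|X_ n w| <= C) -> (forall w, X_ ^~ w @ \oo --> X w) ->
  mean \o X_ @ \oo --> mean X.
Proof.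
move=> bX_ bX XC XX.
have [|||||_ _] := @dominated_convergence _ _ _ P setT measurableT
  (fun n => EFin \o X_ n) (EFin \o X) (cst C%:E).
- by move=> n; apply/measurable_EFinP; case: (bX_ n).
- by apply/measurable_EFinP; case: bX.
- by apply: aeW => w _; apply: cvg_EFin; [exact: nearW|exact: XX].
- exact: (bddmeas_integrable (bddmeas_cst C)).
- by apply: aeW => w n _; rewrite lee_fin.
have -> : (\int[P]_w (EFin \o X) w = (mean X)%:E)%E.
  by rewrite -expectation_mean// unlock.
by move=> /fine_cvg.
Qed.

End BoundedMean.

Section Transfer.
Import HBNNSimple.
Context {R : realType} {d : measure_display} {T : measurableType d}.
Variable P : probability T R.
Context {d' : measure_display} {T' : measurableType d'}.
Implicit Types (X S : {RV P >-> T'}) (f : T' -> R) (Z : T -> R).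

Lemma bddmeas_RV X f : bddmeas f -> bddmeas (fun w => f (X w)).
Proof.
by move=> [mf [C fC]]; split; [exact: measurableT_comp|exists C => w].
Qed.

(** Two functionals of f that agree on indicators agree on bounded measurable
    functions: simple functions by linearity, nonnegative ones by dominated
    convergence, and a constant shift reduces to the nonnegative case. *)
Lemma mean_transfer Z X S c : bddmeas Z ->
  (forall B, measurable B ->
    mean P (fun w => Z w * \1_B (X w)) = c * mean P (fun w => \1_B (S w))) ->
  forall f, bddmeas f ->
    mean P (fun w => Z w * f (X w)) = c * mean P (fun w => f (S w)).
Proof.
move=> bZ ZB.
have simple (g : {nnsfun T' >-> R}) :
    mean P (fun w => Z w * g (X w)) = c * mean P (fun w => g (S w)).
  have bi r Y : bddmeas (fun w => \1_(g @^-1` [set r]) ((Y : {RV P >-> T'}) w) : R).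
    by apply: (bddmeas_RV Y (bddmeas_indic _)); exact: measurable_funPTI.
  transitivity (mean P (fun w => \sum_(i < #|` fset_set (range g)|)
      (fset_set (range g))`_i *
      (Z w * \1_(g @^-1` [set (fset_set (range g))`_i]) (X w)))).
    apply: eq_mean => w; rewrite (fimfunEord g) mulr_sumr.
    by apply: eq_bigr => i _; ring.
  rewrite mean_sum; last by move=> i; apply: bddmeasZ; exact: bddmeasM.
  transitivity (c * \sum_(i < #|` fset_set (range g)|) (fset_set (range g))`_i *
      mean P (fun w => \1_(g @^-1` [set (fset_set (range g))`_i]) (S w))).
    rewrite mulr_sumr; apply: eq_bigr => i _.
    rewrite meanZ; last exact: bddmeasM.
    by rewrite ZB; [rewrite mulrCA|exact: measurable_funPTI].
  congr (c * _).
  transitivity (mean P (fun w => \sum_(i < #|` fset_set (range g)|)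
      (fset_set (range g))`_i *
      \1_(g @^-1` [set (fset_set (range g))`_i]) (S w))).
    rewrite mean_sum; last by move=> i; exact: bddmeasZ.
    by apply: eq_bigr => i _; rewrite meanZ.
  by apply: eq_mean => w; rewrite (fimfunEord g).
have nonneg f : bddmeas f -> (forall t, 0 <= f t) ->
    mean P (fun w => Z w * f (X w)) = c * mean P (fun w => f (S w)).
  move=> bf f0; have [mf [C fC]] := bf; have [mZ [D ZD]] := bZ.
  have mf' : measurable_fun setT (EFin \o f) by exact/measurable_EFinP.
  pose g := nnsfun_approx measurableT mf'.
  have gf n t : 0 <= g n t <= f t.
    rewrite fun_ge0 -lee_fin /g nnsfun_approxE /=.
    by apply: (@le_approx _ _ _ setT (EFin \o f)) => // ? _; rewrite lee_fin.
  have gC n t : `|g n t| <= C.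
    have /andP[g0 gt] := gf n t.
    by rewrite ger0_norm// (le_trans gt)// (le_trans _ (fC t))// ler_norm.
  have bg n : bddmeas (g n) by split; [exact: measurable_funPT|exists C].
  have gcvg t : g ^~ t @ \oo --> f t.
    have := @cvg_nnsfun_approx _ _ _ _ measurableT _ mf' _ t.
    by move=> /(_ (fun _ _ => f0 _) I) /fine_cvg.
  have cvgL : mean P \o (fun n w => Z w * g n (X w)) @ \oo -->
      mean P (fun w => Z w * f (X w)).
    apply: (@mean_cvg _ _ _ _ _ _ (D * C)).
    - by move=> n; apply: bddmeasM => //; exact: bddmeas_RV.
    - by apply: bddmeasM => //; exact: bddmeas_RV.
    - by move=> n w; rewrite normrM ler_pM.
    - by move=> w; apply: cvgMr; exact: gcvg.
  have cvgR : mean P \o (fun n w => g n (S w)) @ \oo --> mean P (fun w => f (S w)).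
    apply: (@mean_cvg _ _ _ _ _ _ C) => //; try exact: bddmeas_RV.
    by move=> n; exact: bddmeas_RV.
  apply: (cvg_unique _ cvgL) => //.
  rewrite (_ : _ \o _ = fun n => c * mean P (fun w => g n (S w))).
    by apply: cvgMr; exact: cvgR.
  by apply/funext => n; exact: (simple (g n)).
(* Reduction to the nonnegative function f + C. *)
move=> f bf; have [mf [C fC]] := bf.
have bfC : bddmeas (fun t => f t + C) by apply: bddmeasD bf (bddmeas_cst _).
have /(nonneg _ bfC) : forall t, 0 <= f t + C.
  by move=> t; rewrite -lerBlDr sub0r; have := fC t; rewrite ler_norml => /andP[].
have Z1 : mean P Z = c.
  have := ZB _ measurableT; rewrite indicT mean_cst mulr1 => <-.
  by apply: eq_mean => w; rewrite mulr1.
have bZf := bddmeasM bZ (bddmeas_RV X bf).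
have -> : mean P (fun w => Z w * (f (X w) + C)) =
    mean P (fun w => Z w * f (X w)) + c * C.
  rewrite -Z1 mulrC -meanZ// -meanD//; last exact: bddmeasZ.
  by apply: eq_mean => w; ring.
rewrite meanD ?mean_cst; [|exact: bddmeas_RV|exact: bddmeas_cst].
by rewrite mulrDr => /addIr.
Qed.

End Transfer.

Section MeanOfNorm.
Context {R : realType} {d : measure_display} {T : measurableType d}.
Variable P : probability T R.

Lemma bddmeas_sqrt (X : T -> R) : bddmeas X -> (forall w, 0 <= X w) ->
  bddmeas (fun w => Num.sqrt (X w)).
Proof.
move=> [mX [C XC]] X0; split; last first.
  exists (Num.sqrt C) => w; rewrite ger0_norm ?sqrtr_ge0// ler_sqrt.
    exact: le_trans (ler_norm _) (XC w).
  by rewrite (le_trans _ (XC w)).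
under eq_fun do rewrite -powR12_sqrt//.
exact: (measurableT_comp (measurable_powR _) mX).
Qed.

(** The variance of X is nonnegative. *)
Lemma mean_le_of_sqr (X : T -> R) c : bddmeas X -> 0 <= c ->
  mean P (fun w => X w ^+ 2) <= c ^+ 2 -> mean P X <= c.
Proof.
move=> bX c0 X2; case: (ltrP (mean P X) 0) => [m0|m0].
  exact: le_trans (ltW m0) c0.
rewrite -(@ler_pXn2r _ 2) ?nnegrE//; apply: le_trans X2.
have bX2 : bddmeas (fun w => X w ^+ 2) by exact: bddmeasM.
set m := mean P X.
have -> : m ^+ 2 = mean P (fun w => (2 * m) * X w + (- m ^+ 2)).
  rewrite meanD ?meanZ ?mean_cst -/m//; [by ring|exact: bddmeasZ|exact: bddmeas_cst].
apply: le_mean => // [|w].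
  by apply: bddmeasD; [exact: bddmeasZ|exact: bddmeas_cst].
by have := sqr_ge0 (X w - m); lra.
Qed.

End MeanOfNorm.

(** * Random matrices with bounded entries *)

Section RandomMatrices.
Context {R : realType} {d : measure_display} {T : measurableType d}.

Definition bddmx m n (M : T -> 'M[R]_(m, n)) : Prop :=
  forall i j, bddmeas (fun w => M w i j).

Lemma bddmx_cst m n (C : 'M[R]_(m, n)) : bddmx (fun=> C).
Proof. by move=> i j; exact: bddmeas_cst. Qed.

Lemma bddmxD m n (M N : T -> 'M[R]_(m, n)) :
  bddmx M -> bddmx N -> bddmx (fun w => M w + N w).
Proof.
by move=> bM bN i j; under eq_fun do rewrite mxE; exact: bddmeasD.
Qed.

Lemma bddmxZ m n a (M : T -> 'M[R]_(m, n)) : bddmx M -> bddmx (fun w => a *: M w).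
Proof.
by move=> bM i j; under eq_fun do rewrite mxE; exact: bddmeasZ.
Qed.

Lemma bddmxN m n (M : T -> 'M[R]_(m, n)) : bddmx M -> bddmx (fun w => - M w).
Proof.
by move=> bM; under eq_fun do rewrite -scaleN1r; exact: bddmxZ.
Qed.

Lemma bddmxM m n p (M : T -> 'M[R]_(m, n)) (N : T -> 'M[R]_(n, p)) :
  bddmx M -> bddmx N -> bddmx (fun w => M w *m N w).
Proof.
move=> bM bN i j; under eq_fun do rewrite mxE.
by apply: bddmeas_sum => k; exact: bddmeasM.
Qed.

Lemma bddmx_tr m n (M : T -> 'M[R]_(m, n)) : bddmx M -> bddmx (fun w => (M w)^T).
Proof. by move=> bM i j; under eq_fun do rewrite mxE; exact: bM. Qed.

Lemma bddmeas_quadform n (M : 'M[R]_n) (v : T -> 'cV[R]_n) :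
  bddmx v -> bddmeas (fun w => quadform M (v w)).
Proof.
move=> bv; under eq_fun do rewrite quadform_sum.
by do 2 (apply: bddmeas_sum => ?); apply: bddmeasZ; exact: bddmeasM.
Qed.

Lemma bddmeas_quadform_mx n (M : T -> 'M[R]_n) v :
  bddmx M -> bddmeas (fun w => quadform (M w) v).
Proof.
move=> bM; under eq_fun do rewrite quadform_sum.
by do 2 (apply: bddmeas_sum => ?); apply: bddmeasM (bddmeas_cst _).
Qed.

Variable P : probability T R.

Lemma expectation_mxE m n (M : T -> 'M[R]_(m, n)) i j :
  expectation_mx P M i j = mean P (fun w => M w i j).
Proof. by rewrite mxE fine_expectation. Qed.

Lemma expectation_mxM m n p q (C : 'M[R]_(m, n)) (M : T -> 'M[R]_(n, p))
    (D : 'M[R]_(p, q)) : bddmx M ->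
  expectation_mx P (fun w => C *m M w *m D) = C *m expectation_mx P M *m D.
Proof.
move=> bM; apply/matrixP => i j; rewrite expectation_mxE mxE.
transitivity (mean P (fun w => \sum_k \sum_l D k j * (C i l * M w l k))).
  apply: eq_mean => w; rewrite mxE; apply: eq_bigr => k _.
  by rewrite mxE mulrC mulr_sumr.
rewrite mean_sum; last first.
  by move=> k; apply: bddmeas_sum => l; do 2 apply: bddmeasZ.
apply: eq_bigr => k _; rewrite mean_sum; last by move=> l; do 2 apply: bddmeasZ.
rewrite mxE mulrC mulr_sumr; apply: eq_bigr => l _.
by rewrite !meanZ ?expectation_mxE//; exact: bddmeasZ.
Qed.

Lemma mean_quadform n (M : T -> 'M[R]_n) v : bddmx M ->
  mean P (fun w => quadform (M w) v) = quadform (expectation_mx P M) v.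
Proof.
move=> bM; rewrite /quadform -expectation_mxM// expectation_mxE.
by apply: eq_mean.
Qed.

Lemma trmx_expectation n (M : T -> 'M[R]_n) : (forall w, (M w)^T = M w) ->
  (expectation_mx P M)^T = expectation_mx P M.
Proof.
move=> sM; apply/matrixP => i j; rewrite mxE !expectation_mxE.
by apply: eq_mean => w; rewrite -{1}sM mxE.
Qed.

End RandomMatrices.

Section BlockMatrices.
Context {R : realType}.

Lemma bddmx_col_mx d (T : measurableType d) m1 m2 n (M : T -> 'M[R]_(m1, n))
    (N : T -> 'M[R]_(m2, n)) :
  bddmx M -> bddmx N -> bddmx (fun t => col_mx (M t) (N t)).
Proof.
by move=> bM bN i j; under eq_fun do rewrite mxE; case: (fintype.split i) => l.
Qed.

Lemma quadform_diag_block n1 n2 (M : 'M[R]_n1) (N : 'M[R]_n2) u v :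
  quadform (block_mx M 0 0 N) (col_mx u v) = quadform M u + quadform N v.
Proof.
by rewrite /quadform tr_col_mx mul_row_block !mulmx0 addr0 add0r mul_row_col mxE.
Qed.

Lemma quadformZ n a (M : 'M[R]_n) v : quadform (a *: M) v = a * quadform M v.
Proof. by rewrite !quadformE -scalemxAl dotvZr. Qed.

End BlockMatrices.

(** * Independence of the past and random linear recursions *)

Section Past.
Context {R : realType} {d : measure_display} {T : measurableType d}.
Variable P : probability T R.
Context {d' : measure_display} {T' : measurableType d'}.
Variables (S : {RV P >-> T'}) (Sk : nat -> {RV P >-> T'}).

Definition indic_prod m k (B : nat -> set T') (w : T) : R :=
  \prod_(j < m) \1_(B j) (Sk (k + j) w).

(** X is treated as a function of S_0, ..., S_(k-1): it is independent of the block
    S_k, ..., S_(k+m-1) for every m, the later samples having the law of S. Taking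
    blocks of every length makes [past_next] go through; products of two members of
    the class need not belong to it, which is why the induction on the state is made
    on products of two of its entries. *)
Definition past k (X : T -> R) : Prop := bddmeas X /\
  forall m B, (forall j, measurable (B j)) ->
    mean P (fun w => X w * indic_prod m k B w) =
    mean P X * \prod_(j < m) mean P (fun w => \1_(B j) (S w)).

Lemma bddmeas_indic_prod m k B : (forall j, measurable (B j)) ->
  bddmeas (indic_prod m k B).
Proof.
by move=> mB; apply: bddmeas_prod => j; apply: bddmeas_RV; exact: bddmeas_indic.
Qed.

Lemma pastD k X Y : past k X -> past k Y -> past k (fun w => X w + Y w).
Proof.
move=> [bX pX] [bY pY]; split=> [|m B mB]; first exact: bddmeasD.
have bB := bddmeas_indic_prod m k mB.
rewrite meanD// mulrDl -pX// -pY// -meanD; [|exact: bddmeasM..].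
by apply: eq_mean => w; rewrite mulrDl.
Qed.

Lemma past_sum k (I : Type) (r : seq I) (X : I -> T -> R) :
  (forall i, past k (X i)) -> past k (fun w => \sum_(i <- r) X i w).
Proof.
move=> pX; elim: r => [|i r IHr].
  under eq_fun do rewrite big_nil; split=> [|m B mB]; first exact: bddmeas_cst.
  by under eq_fun do rewrite mul0r; rewrite mean_cst mul0r.
by under eq_fun do rewrite big_cons; exact: pastD.
Qed.

(** For f an indicator this is the defining property of the class for the block
    extended by S_k; [mean_transfer] does the rest. *)
Lemma past_indep k m B X f : past k X -> (forall j, measurable (B j)) ->
  bddmeas f ->
  mean P (fun w => X w * indic_prod m k.+1 B w * f (Sk k w)) =
  mean P X * (\prod_(j < m) mean P (fun w => \1_(B j) (S w))) *
  mean P (fun w => f (S w)).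
Proof.
move=> [bX pX] mB bf; apply: mean_transfer => //.
  exact/bddmeasM/bddmeas_indic_prod.
(* B' is the sequence of events of the block of length m + 1 that starts at S_k. *)
move=> B0 mB0; pose B' j := if j is j'.+1 then B j' else B0.
have := pX m.+1 B'; rewrite big_ord_recl /= => e.
rewrite -mulrA [X in _ * X]mulrC -e; last by case.
apply: eq_mean => w; rewrite -mulrA; congr (_ * _).
rewrite /indic_prod big_ord_recl /= addn0 mulrC; congr (_ * _).
by apply: eq_bigr => j _; rewrite addnS addSn.
Qed.

Lemma past_mean k X f : past k X -> bddmeas f ->
  mean P (fun w => X w * f (Sk k w)) = mean P X * mean P (fun w => f (S w)).
Proof.
move=> pX bf; have := @past_indep k 0 (fun=> setT) X f pX (fun=> measurableT) bf.
rewrite big_ord0 mulr1 => <-; apply: eq_mean => w.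
by rewrite /indic_prod big_ord0 mulr1.
Qed.

Lemma past_next k X f : past k X -> bddmeas f ->
  past k.+1 (fun w => X w * f (Sk k w)).
Proof.
move=> pX bf; have [bX _] := pX; split=> [|m B mB].
  by apply: bddmeasM => //; exact: bddmeas_RV.
rewrite past_mean// mulrAC -(past_indep m pX mB bf); apply: eq_mean => w.
by rewrite mulrAC.
Qed.

Hypothesis Slaw : forall k, same_law (Sk k) S.
Hypothesis Sindep : mutually_independent Sk.

(** This is where the product rule of mutual independence enters. *)
Lemma past_cst a : past 0 (fun=> a).
Proof.
split=> [|m B mB]; first exact: bddmeas_cst.
have bB := bddmeas_indic_prod m 0 mB.
rewrite meanZ// mean_cst; congr (_ * _).
pose J := index_iota 0 m.
transitivity (fine (P (\bigcap_(i in [set` J]) (Sk i @^-1` B i)))).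
  rewrite -mean_indic; last first.
    by apply: fin_bigcap_measurable => // i _; exact: measurable_funPTI.
  apply: eq_mean => w; rewrite indicE; case: (boolP (_ \in _)) => wB.
    rewrite /indic_prod big1// => j _; rewrite indicE add0n mem_set//.
    by move/set_mem : wB => /(_ j); apply; rewrite /= mem_index_iota /=.
  move: wB; rewrite notin_setE => /existsNP[i /not_implyP[/= iJ nB]].
  move: iJ; rewrite mem_index_iota /= => im.
  by rewrite /indic_prod (bigD1 (Ordinal im))//= indicE memNset ?mul0r.
rewrite Sindep ?iota_uniq//.
under eq_bigr => i _.
  rewrite (_ : P _ = (mean P (fun w => \1_(B i) (S w)))%:E); first over.
  rewrite [LHS](Slaw i (mB i)) (_ : (fun w => _) = \1_(S @^-1` B i))//.
  by rewrite mean_indic ?fineK ?fin_num_measure//; exact: measurable_funPTI.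
by rewrite prodEFin /J big_mkord.
Qed.

End Past.

Section LinearRecursion.
Context {R : realType} {d : measure_display} {T : measurableType d}.
Variable P : probability T R.
Context {d' : measure_display} {T' : measurableType d'}.
Variables (S : {RV P >-> T'}) (Sk : nat -> {RV P >-> T'}).
Hypothesis Slaw : forall k, same_law (Sk k) S.
Hypothesis Sindep : mutually_independent Sk.
Variables (m : nat) (F : T' -> 'M[R]_m) (s : nat -> T -> 'cV[R]_m) (s0 : 'cV[R]_m).
Hypothesis bF : bddmx F.
Hypothesis s_init : forall w, s 0 w = s0.
Hypothesis s_rec : forall k w, s k.+1 w = F (Sk k w) *m s k w.

(** Induction on k for all pairs of entries at once: an entry of s_(k+1) is a sum of
    entries of s_k times functions of S_k. *)
Lemma past_state k i j : past S Sk k (fun w => s k w i 0 * s k w j 0).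
Proof.
elim: k i j => [|k IHk] i j.
  by under eq_fun do rewrite s_init; exact: past_cst.
under eq_fun do rewrite s_rec !mxE mulr_suml.
apply: past_sum => a; under eq_fun do rewrite mulr_sumr.
apply: past_sum => b.
have -> : (fun w => F (Sk k w) i a * s k w a 0 * (F (Sk k w) j b * s k w b 0)) =
    (fun w => s k w a 0 * s k w b 0 * ((fun t => F t i a * F t j b) (Sk k w))).
  by apply/funext => w /=; ring.
exact: (past_next (IHk a b) (bddmeasM (bF i a) (bF j b))).
Qed.

Lemma bddmx_state k : bddmx (s k).
Proof.
elim: k => [|k IHk].
  by rewrite (_ : s 0 = fun=> s0); [exact: bddmx_cst|exact/funext].
rewrite (_ : s k.+1 = fun w => F (Sk k w) *m s k w); last exact/funext/s_rec.
apply: bddmxM => // i j.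
exact: (bddmeas_RV (Sk k) (bF i j)).
Qed.

(** A Lyapunov function that contracts in mean from every deterministic state
    contracts along the recursion, because the state is independent of the next
    sample. *)
Lemma lyapunov_decay (Q : 'M[R]_m) rho : 0 <= rho ->
  (forall v, mean P (fun w => quadform Q (F (S w) *m v)) <= rho * quadform Q v) ->
  forall k, mean P (fun w => quadform Q (s k w)) <= rho ^+ k * quadform Q s0.
Proof.
move=> rho0 decay; elim=> [|k IHk].
  by rewrite expr0 mul1r; under eq_mean do rewrite s_init; rewrite mean_cst.
rewrite exprS -mulrA; apply: le_trans (ler_wpM2l rho0 IHk).
pose N t := (F t)^T *m Q *m F t.
have bN : bddmx N by do 2 (apply: bddmxM => //); [exact: bddmx_tr|exact: bddmx_cst].
have bNS : bddmx (fun w => N (S w)) by move=> i j; exact: (bddmeas_RV S (bN i j)).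
have quadN t v : quadform Q (F t *m v) = quadform (N t) v.
  by rewrite /quadform trmx_mul !mulmxA.
pose EN := expectation_mx P (fun w => N (S w)).
have bs := bddmx_state k.
have -> : mean P (fun w => quadform Q (s k.+1 w)) = mean P (fun w => quadform EN (s k w)).
  transitivity (mean P (fun w => \sum_i \sum_j
      s k w i 0 * s k w j 0 * (fun t => N t i j) (Sk k w))).
    apply: eq_mean => w; rewrite s_rec quadN quadform_sum.
    by apply: eq_bigr => i _; apply: eq_bigr => j _; rewrite mulrC.
  transitivity (mean P (fun w => \sum_i \sum_j
      EN i j * (s k w i 0 * s k w j 0))); last first.
    by apply: eq_mean => w; rewrite quadform_sum.
  have bp i j := bddmeasM (bs i 0) (bs j 0).
  have bq i j := bddmeasM (bp i j) (bddmeas_RV (Sk k) (bN i j)).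
  rewrite !mean_sum; try by move=> i; apply: bddmeas_sum => j //; exact: bddmeasZ.
  apply: eq_bigr => i _; rewrite !mean_sum//; last by move=> j; exact: bddmeasZ.
  apply: eq_bigr => j _.
  rewrite meanZ// [EN i j]expectation_mxE mulrC.
  exact: (past_mean (past_state k i j) (bN i j)).
rewrite -meanZ; last exact: bddmeas_quadform.
apply: le_mean; [exact: bddmeas_quadform|exact/bddmeasZ/bddmeas_quadform|].
move=> w; rewrite -mean_quadform//.
by under eq_mean do rewrite -quadN.
Qed.

End LinearRecursion.

(** * Borel measurability of the range projector *)

Section Measurability.
Context {R : realType}.

Lemma measurable_entry n p i j :
  measurable_fun setT (fun M : borelMx R n p => (M : 'M[R]_(n, p)) i j).
Proof.
apply: (measurability _ (RGenOpens.measurableE R)) => _ [_ [a [b ->]] <-].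
rewrite setTI; apply: sub_sigma_algebra.
move: (@coord_continuous R n p i j) => /continuousP; apply; exact: interval_open.
Qed.

(** The inverse of a nonnegative real is its power with exponent -1, at 0 too. *)
Lemma measurable_inv_ge0 d (T : measurableType d) (f : T -> R) :
  measurable_fun setT f -> (forall t, 0 <= f t) ->
  measurable_fun setT (fun t => (f t)^-1).
Proof.
move=> mf f0; under eq_fun do rewrite -powR_inv1//.
exact: (measurableT_comp (measurable_powR (-1)) mf).
Qed.

Lemma measurable_col_proj d (T : measurableType d) m n (M : T -> 'M[R]_(m, n)) s :
  (forall i j, measurable_fun setT (fun t => M t i j)) ->
  forall i j, measurable_fun setT (fun t => col_proj (M t) s i j).
Proof.
move=> mM; elim: s => [|c s IHs] i j /=.
  by under eq_fun do rewrite mxE; exact: measurable_cst.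
pose v t := col c (M t) - col_proj (M t) s *m col c (M t).
have mv k : measurable_fun setT (fun t => v t k 0).
  under eq_fun do rewrite /v !mxE; apply: measurable_funB; first exact: mM.
  by apply: measurable_sum => l; under eq_fun do rewrite !mxE; exact: measurable_funM.
have -> : (fun t => (col_proj (M t) s + (dotv (v t) (v t))^-1 *:
      (v t *m (v t)^T)) i j) =
    (fun t => col_proj (M t) s i j + (dotv (v t) (v t))^-1 * (v t i 0 * v t j 0)).
  by apply/funext => t; rewrite !mxE big_ord1 !mxE.
apply: measurable_funD => //; apply: measurable_funM; last exact: measurable_funM.
apply: measurable_inv_ge0 => [|t]; last exact: dotv_ge0.
under eq_fun do rewrite dotvE; apply: measurable_sum => k.
exact: measurable_funM.
Qed.

(** Measurable because Gram-Schmidt uses only the field operations; bounded because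
    the entries of a projector are. *)
Lemma bddmx_range_proj m n p (B : 'M[R]_(m, n)) :
  bddmx (fun M : borelMx R n p => range_proj (B *m M)).
Proof.
move=> i j; split.
  under eq_fun do rewrite range_projE; apply: measurable_col_proj => {}i {}j.
  under eq_fun do rewrite mxE; apply: measurable_sum => k.
  by apply: measurable_funM; [exact: measurable_cst|exact: measurable_entry].
exists 1 => M; have [sQ iQ _] := range_projP (B *m (M : 'M[R]_(n, p))).
exact: proj_entry_le1.
Qed.

Lemma gs_HE n p (A : 'M[R]_n) (S : 'M[R]_(n, p)) : posdefmx A ->
  gs_H A S = invmx (sqrt_mx A) *m range_proj (sqrt_mx A *m S) *m invmx (sqrt_mx A).
Proof.
move=> pA; have uB := sqrt_mx_unit pA.
by rewrite -gs_H_proj// !mulmxA mulVmx// mul1mx mulmxK.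
Qed.

Lemma bddmx_gs_H n p (A : 'M[R]_n) : posdefmx A ->
  bddmx (fun S : borelMx R n p => gs_H A S).
Proof.
move=> pA; under eq_fun do rewrite gs_HE//.
apply: bddmxM; last exact: bddmx_cst.
by apply: bddmxM; [exact: bddmx_cst|exact: bddmx_range_proj].
Qed.

End Measurability.

(** * Mean contraction of the Lyapunov function in one step *)

Section OneStep.
Context {R : realType} {d : measure_display} {T : measurableType d}.
Variables (P : probability T R) (n : nat) (A Gi : 'M[R]_n) (H : T -> 'M[R]_n).
Variables mu nu tau : R.
Let G := expectation_mx P H.
Hypotheses (bH : bddmx H) (psdA : possemidefmx A) (psdGi : possemidefmx Gi).
Hypotheses (sH : forall w, (H w)^T = H w) (HAH : forall w, H w *m A *m H w = H w).
Hypothesis GiG : Gi *m G = 1%:M.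
Hypothesis Gi_le : forall e, mu * quadform Gi e <= quadform A e.
Hypothesis HGiH_le : forall g,
  quadform (expectation_mx P (fun w => H w *m Gi *m H w)) g <= nu * quadform G g.
Hypotheses (mu0 : 0 < mu) (tau0 : 0 <= tau) (tau1 : tau <= 1).
Hypothesis tau_nu : tau ^+ 2 * nu = mu.

Lemma psd_convex e f : quadform Gi ((1 - tau) *: e + tau *: f) <=
  (1 - tau) * quadform Gi e + tau * quadform Gi f.
Proof.
have := (proj2 psdGi) (e - f); rewrite !quadformE !(mulmxDr, mulmxN) -!scalemxAr.
rewrite !dotv_lin -[dotv f (Gi *m e)](symmx_dotv _ _ (proj1 psdGi)) dotvC.
set a := dotv e (Gi *m e); set b := dotv e (Gi *m f); set c := dotv f _ => abc.
have := mulr_ge0 (mulr_ge0 tau0 (_ : 0 <= 1 - tau)) abc.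
rewrite subr_ge0 => /(_ tau1); lra.
Qed.

(** The state (ey, ez) is fixed and only H is random. After the squares are expanded
    with H A H = H, the random terms are linear in H or in H G^-1 H, so that their
    means are known or bounded. *)
Lemma one_step ey ez ex : (1 + tau) *: ex = ey + tau *: ez ->
  mean P (fun w => quadform A (ex - H w *m (A *m ex)) +
    mu * quadform Gi (ez + tau *: (ex - ez) - (tau / mu) *: (H w *m (A *m ex)))) <=
  (1 - tau) * (quadform A ey + mu * quadform Gi ez).
Proof.
move=> exE; have [g gE] : {g | A *m ex = g} by exists (A *m ex).
have [u uE] : {u | u = (1 - tau) *: ez + tau *: ex}.
  by exists ((1 - tau) *: ez + tau *: ex).
have -> : ez + tau *: (ex - ez) = u.
  by rewrite uE scalerBr scalerBl scale1r addrA addrAC.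
have sA := proj1 psdA; have sGi := proj1 psdGi.
have pt w : quadform A (ex - H w *m g) + mu * quadform Gi (u - (tau / mu) *: (H w *m g)) =
    (quadform A ex + mu * quadform Gi u) + ((- (2 * tau)) * dotv (Gi *m u) (H w *m g)
    + ((tau ^+ 2 / mu) * quadform (H w *m Gi *m H w) g + (- 1) * quadform (H w) g)).
  rewrite !quadformE !(mulmxDr, mulmxN) -!scalemxAr !dotv_lin.
  have -> : dotv (H w *m g) (A *m ex) = dotv g (H w *m g) by rewrite gE dotvC.
  have -> : dotv ex (A *m (H w *m g)) = dotv g (H w *m g) by rewrite -symmx_dotv ?gE.
  have -> : dotv (H w *m g) (A *m (H w *m g)) = dotv g (H w *m g).
    by rewrite symmx_dotv// !mulmxA HAH.
  have -> : dotv (H w *m g) (Gi *m u) = dotv (Gi *m u) (H w *m g) by rewrite dotvC.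
  have -> : dotv u (Gi *m (H w *m g)) = dotv (Gi *m u) (H w *m g).
    by rewrite symmx_dotv.
  have -> : dotv (H w *m g) (Gi *m (H w *m g)) = dotv g (H w *m Gi *m H w *m g).
    by rewrite symmx_dotv// !mulmxA.
  by field; rewrite gt_eqF.
rewrite gE; under eq_mean do rewrite pt.
have bHg : bddmx (fun w => H w *m g) by apply: bddmxM (bddmx_cst _).
have bd (v : 'cV[R]_n) : bddmeas (fun w => dotv v (H w *m g)).
  by rewrite /dotv; apply: (bddmxM (bddmx_cst _) _ _ _).
have bHGH : bddmx (fun w => H w *m Gi *m H w).
  by apply: bddmxM => //; apply: bddmxM => //; exact: bddmx_cst.
have md : mean P (fun w => dotv (Gi *m u) (H w *m g)) = dotv u g.
  have -> : dotv u g = ((Gi *m u)^T *m G *m g) 0 0.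
    by rewrite trmx_mul sGi -(mulmxA _ Gi) GiG mulmx1.
  by rewrite -expectation_mxM// expectation_mxE; apply: eq_mean => w; rewrite /dotv mulmxA.
have bqH := bddmeas_quadform_mx g bH; have bqHGH := bddmeas_quadform_mx g bHGH.
rewrite meanD; [|exact: bddmeas_cst|]; last first.
  by do 2 (apply: bddmeasD; first exact: bddmeasZ); exact: bddmeasZ.
rewrite mean_cst meanD; [|exact: bddmeasZ|]; last first.
  by apply: bddmeasD; exact: bddmeasZ.
rewrite meanZ// meanD ?meanZ//; [|exact: bddmeasZ..].
rewrite md !mean_quadform// -/G.
have nuG := HGiH_le g; set q := quadform G g in nuG *.
(* The choice of tau makes the second moment term at most the decrease g^T G g. *)
have step : tau ^+ 2 / mu * quadform (expectation_mx P (fun w => H w *m Gi *m H w)) g <= q.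
  apply: le_trans (ler_wpM2l _ nuG) _; first by rewrite divr_ge0 ?sqr_ge0// ltW.
  by rewrite mulrA [_ / _ * nu]mulrAC tau_nu divff ?mul1r// gt_eqF.
have conv := psd_convex ez ex; rewrite -uE in conv.
have Giex := Gi_le ex.
(* The coupling of y and z: tau u = e_x - (1 - tau) e_y. *)
have tu : tau * dotv u g = quadform A ex - (1 - tau) * dotv ey g.
  rewrite quadformE gE -dotvZl -dotvZl -dotvNl -dotvDl; congr dotv.
  have -> : tau *: u = (1 - tau) *: (tau *: ez) + tau ^+ 2 *: ex.
    by rewrite uE scalerDr !scalerA expr2 mulrC.
  have -> : tau *: ez = (1 + tau) *: ex - ey by rewrite exE addrC addKr.
  rewrite scalerBr scalerA addrAC -scalerDl (_ : _ + _ = 1) ?scale1r//.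
  by ring.
have Aey : 0 <= quadform A ex - 2 * dotv ey g + quadform A ey.
  have := (proj2 psdA) (ex - ey); rewrite !quadformE !(mulmxDr, mulmxN) !dotv_lin gE.
  by rewrite -[dotv ex (A *m ey)]symmx_dotv// gE (dotvC g) => /le_trans; apply; lra.
have tau1' : 0 <= 1 - tau by rewrite subr_ge0.
have h1 := ler_wpM2l (ltW mu0) conv; have h2 := ler_wpM2l tau0 Giex.
have h3 := mulr_ge0 tau1' Aey.
lra.
Qed.

End OneStep.

(** * The constants mu, nu and tau *)

Section Constants.
Context {R : realType} {d : measure_display} {T : measurableType d}.
Variables (P : probability T R) (n p : nat) (A : 'M[R]_n).
Variable S : {RV P >-> borelMx R n p}.
Hypotheses (pA : posdefmx A) (mu0 : 0 < gs_mu A P S).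
Let mu := gs_mu A P S.
Let nu := gs_nu A P S.
Let G := gs_G A P S.
Let B := sqrt_mx A.
Let D := sqrt_mx G.
Let Gi := invmx D *m invmx D.
Let H w := gs_H A (S w).

Lemma bddmx_gs_H_sample : bddmx H.
Proof. by move=> i j; exact: (bddmeas_RV S (@bddmx_gs_H R n p A pA i j)). Qed.

Lemma bddmx_proj_sample : bddmx (fun w => range_proj (B *m S w)).
Proof. by move=> i j; exact: (bddmeas_RV S (@bddmx_range_proj R n n p B i j)). Qed.

Lemma sqrt_A_spec : [/\ B^T = B, B *m B = A & B \in unitmx].
Proof. by have [[sB _] BB] := sqrt_mxP (posdef_psd pA); split=> //; exact: sqrt_mx_unit. Qed.

Lemma conj_gs_G : B *m G *m B = expectation_mx P (fun w => range_proj (B *m S w)).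
Proof.
rewrite -expectation_mxM; last exact: bddmx_gs_H_sample.
by congr expectation_mx; apply/funext => w; rewrite gs_H_proj.
Qed.

Lemma trmx_gs_G : G^T = G.
Proof. by apply: trmx_expectation => w; exact: trmx_gs_H. Qed.

Lemma mu_le_quadform v : mu * dotv v v <= quadform (B *m G *m B) v.
Proof.
rewrite conj_gs_G; apply: lambda_min_le; apply: trmx_expectation => w.
by have [] := range_projP (B *m S w).
Qed.

(** This is G >= mu A^-1. *)
Lemma mu_le_gs_G v : mu * dotv (invmx B *m v) (invmx B *m v) <= quadform G v.
Proof.
have [sB _ uB] := sqrt_A_spec; have := mu_le_quadform (invmx B *m v).
rewrite [X in _ <= X]quadformE -!mulmxA (mulmxA B (invmx B)) mulmxV// mul1mx.
by rewrite -symmx_dotv// mulmxA mulmxV// mul1mx -quadformE.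
Qed.

Lemma posdef_gs_G : posdefmx G.
Proof.
split=> [|v v0]; first exact: trmx_gs_G.
apply: lt_le_trans (mu_le_gs_G v); rewrite mulr_gt0// dotv_gt0//.
have [_ _ uB] := sqrt_A_spec; apply: contraNneq v0 => v0.
by rewrite -[v]mul1mx -(mulmxV uB) -mulmxA v0 mulmx0.
Qed.

Lemma sqrt_G_spec : [/\ D^T = D, D *m D = G & D \in unitmx].
Proof.
have [[sD _] DD] := sqrt_mxP (posdef_psd posdef_gs_G).
by split=> //; exact: (sqrt_mx_unit posdef_gs_G).
Qed.

Lemma trmx_inv_sqrt_G : (invmx D)^T = invmx D.
Proof. by have [sD _ _] := sqrt_G_spec; rewrite trmx_inv sD. Qed.

Lemma quadform_inv_G v : quadform Gi v = dotv (invmx D *m v) (invmx D *m v).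
Proof. by rewrite quadformE -mulmxA symmx_dotv// trmx_inv_sqrt_G. Qed.

Lemma psd_inv_G : possemidefmx Gi.
Proof.
split; first by rewrite trmx_mul trmx_inv_sqrt_G.
by move=> v; rewrite quadform_inv_G dotv_ge0.
Qed.

Lemma mul_inv_G : Gi *m G = 1%:M.
Proof.
have [_ DD uD] := sqrt_G_spec.
by rewrite /Gi -[X in _ *m X]DD mulmxA -(mulmxA (invmx D)) mulVmx// mulmx1 mulVmx.
Qed.

(** With f = G^-1 e, the square |mu A^(-1/2) f - A^(1/2) e|^2 is nonnegative and
    mu A^-1 <= G. *)
Lemma mu_inv_G_le e : mu * quadform Gi e <= quadform A e.
Proof.
have [sB BB uB] := sqrt_A_spec; pose f := Gi *m e.
have Gf : G *m f = e.
  have GGi : G *m Gi = 1%:M by apply: mulmx1C; exact: mul_inv_G.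
  by rewrite mulmxA GGi mul1mx.
have := dotv_ge0 (mu *: (invmx B *m f) - B *m e); rewrite !dotv_lin.
have -> : dotv (B *m e) (B *m e) = quadform A e.
  by rewrite symmx_dotv// mulmxA BB -quadformE.
have -> : dotv (B *m e) (invmx B *m f) = dotv e f.
  by rewrite symmx_dotv// mulmxA mulmxV// mul1mx.
have -> : dotv (invmx B *m f) (B *m e) = dotv e f.
  by rewrite dotvC symmx_dotv// mulmxA mulmxV// mul1mx.
have := ler_wpM2l (ltW mu0) (mu_le_gs_G f); rewrite -/mu quadformE Gf dotvC.
have -> : quadform Gi e = dotv e f by rewrite quadformE.
lra.
Qed.

Let K w := invmx D *m H w *m invmx D.

Lemma bddmx_K : bddmx K.
Proof.
by apply: bddmxM (bddmx_cst _); apply: bddmxM (bddmx_cst _) _; exact: bddmx_gs_H_sample.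
Qed.

Lemma trmx_K w : (K w)^T = K w.
Proof.
rewrite trmx_mul [(_ *m H w)^T]trmx_mul trmx_inv_sqrt_G mulmxA.
by rewrite (_ : (H w)^T = H w)//; exact: trmx_gs_H.
Qed.

Lemma mean_sqr_K_le v : quadform (expectation_mx P (fun w => K w *m K w)) v <= nu * dotv v v.
Proof.
by apply: lambda_max_ge; apply: trmx_expectation => w; rewrite trmx_mul !trmx_K.
Qed.

(** Conjugating E[K^2] <= nu by G^(1/2) turns K^2 into H G^-1 H. *)
Lemma mean_HGiH_le g :
  quadform (expectation_mx P (fun w => H w *m Gi *m H w)) g <= nu * quadform G g.
Proof.
have [sD DD uD] := sqrt_G_spec; have := mean_sqr_K_le (D *m g).
have -> : dotv (D *m g) (D *m g) = quadform G g.
  by rewrite symmx_dotv// mulmxA DD -quadformE.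
apply: le_trans; rewrite -!mean_quadform; last 2 first.
- exact: bddmxM bddmx_K bddmx_K.
- by apply: bddmxM bddmx_gs_H_sample; apply: bddmxM bddmx_gs_H_sample (bddmx_cst _).
rewrite le_eqVlt; apply/orP; left; apply/eqP/eq_mean => w.
rewrite !quadformE symmx_dotv//; congr dotv.
by rewrite /K /Gi !mulmxA mulmxV// mul1mx -!mulmxA mulKmx.
Qed.

Lemma dim_gt0 : (0 < n)%N.
Proof.
rewrite lt0n; apply/eqP => n0; move: mu0; rewrite /gs_mu.
move: (expectation_mx _ _); rewrite n0 => M.
by rewrite lambda_min_dim0 ltxx.
Qed.

Lemma ex_unit_vector : exists v : 'cV[R]_n, dotv v v = 1.
Proof.
have [||v [_ [v1 _ _]]] := @max_rayleigh R n 0; [exact: dim_gt0|exact: trmx0|].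
by exists v.
Qed.

(** The mean of projectors is bounded by the identity. *)
Lemma mu_le1 : mu <= 1.
Proof.
have [v v1] := ex_unit_vector.
have := mu_le_quadform v; rewrite v1 mulr1 conj_gs_G => /le_trans; apply.
rewrite -mean_quadform; last exact: bddmx_proj_sample.
rewrite -[leRHS](mean_cst P); apply: le_mean => [||w].
- exact/bddmeas_quadform_mx/bddmx_proj_sample.
- exact: bddmeas_cst.
- by rewrite -v1; have [sQ iQ _] := range_projP (B *m S w); exact: proj_quadform_le.
Qed.

(** E[K] = 1 and E[(K - 1)^2] >= 0. *)
Lemma nu_ge1 : 1 <= nu.
Proof.
have [v v1] := ex_unit_vector; have [sD DD uD] := sqrt_G_spec.
have EK : expectation_mx P K = 1%:M.
  rewrite /K expectation_mxM; last exact: bddmx_gs_H_sample.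
  by rewrite -[expectation_mx _ _]/G -DD mulmxA mulVmx// mul1mx mulmxV.
have bKK : bddmx (fun w => K w *m K w) := bddmxM bddmx_K bddmx_K.
have := mean_sqr_K_le v; rewrite v1 mulr1; apply: le_trans.
rewrite -mean_quadform//.
suff : 2 * mean P (fun w => quadform (K w) v) + (-1) <=
    mean P (fun w => quadform (K w *m K w) v).
  by rewrite mean_quadform ?EK; [rewrite quadformE mul1mx v1; lra|exact: bddmx_K].
have bK := bddmeas_quadform_mx v bddmx_K.
rewrite -meanZ// -(mean_cst P (-1)) -meanD; [|exact: bddmeasZ|exact: bddmeas_cst].
apply: le_mean => [||w]; [|exact: bddmeas_quadform_mx|].
  by apply: bddmeasD (bddmeas_cst _); exact: bddmeasZ.
have := dotv_ge0 (K w *m v - v); rewrite !dotv_lin v1 !quadformE.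
rewrite symmx_dotv ?trmx_K// (dotvC (K w *m v)) mulmxA; lra.
Qed.

Let tau := gs_tau A P S.

Lemma tau_ge0 : 0 <= tau.
Proof. exact: sqrtr_ge0. Qed.

Lemma tau_le1 : tau <= 1.
Proof.
rewrite -sqrtr1 ler_sqrt// ler_pdivrMr ?mul1r.
  exact: le_trans mu_le1 nu_ge1.
exact: lt_le_trans nu_ge1.
Qed.

Lemma tau_nu : tau ^+ 2 * nu = mu.
Proof.
have nu0 : 0 < nu by exact: lt_le_trans nu_ge1.
rewrite /tau /gs_tau -/mu -/nu sqr_sqrtr; first by rewrite divfK// gt_eqF.
by rewrite divr_ge0// ltW.
Qed.

End Constants.

(** * Convergence of the iteration *)

Theorem theorem3p5 (R : realType) (d : measure_display) (T : measurableType d)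
    (P : probability T R) (n p : nat)
    (A : 'M[R]_n) (b xstar : 'cV[R]_n)
    (S : {RV P >-> borelMx R n p}) (Sk : nat -> {RV P >-> borelMx R n p})
    (x0 : 'cV[R]_n) (x y z : nat -> T -> 'cV[R]_n) :
  let mu := gs_mu A P S in
  let tau := gs_tau A P S in
  let H := fun k w => gs_H A (Sk k w) in
  posdefmx A ->
  A *m xstar = b ->
  (forall k, same_law (Sk k) S) ->
  mutually_independent Sk ->
  0 < mu ->
  (forall w, x 0%N w = x0) ->
  (forall w, y 0%N w = x0) ->
  (forall w, z 0%N w = x0) ->
  (forall k w, x k.+1 w = (1 + tau)^-1 *: y k w + (tau / (1 + tau)) *: z k w) ->
  (forall k w, y k.+1 w = x k.+1 w - H k w *m (A *m x k.+1 w - b)) ->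
  (forall k w, z k.+1 w = z k w + tau *: (x k.+1 w - z k w)
                          - (tau / mu) *: (H k w *m (A *m x k.+1 w - b))) ->
  forall k : nat,
    ('E_P[fun w => norm_mx A (y k w - xstar)]
      <= (Num.sqrt 2 * (1 - tau) `^ (k%:R / 2) * norm_mx A (x0 - xstar))%:E)%E.
Proof.
move=> mu tau H pA Axb Slaw Sindep mu0 _ y0 z0 xS yS zS k.
have psdA := posdef_psd pA; have tau0 : 0 <= tau := tau_ge0 A S.
have tau1 : tau <= 1 := tau_le1 pA mu0.
have tau_pos : 0 < 1 + tau by rewrite ltr_pwDl.
pose D := sqrt_mx (gs_G A P S); pose Gi := invmx D *m invmx D.
(* On the stacked errors (e_y, e_z), X computes e_x and Z selects e_z. *)
pose X : 'M[R]_(n, n + n) :=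
  row_mx ((1 + tau)^-1)%:M (tau / (1 + tau))%:M.
pose Z : 'M[R]_(n, n + n) := row_mx 0 1%:M.
pose F (t : borelMx R n p) : 'M[R]_(n + n) :=
  col_mx (X - gs_H A t *m (A *m X))
    (Z + tau *: (X - Z) - (tau / mu) *: (gs_H A t *m (A *m X))).
pose e0 := x0 - xstar; pose s k w := col_mx (y k w - xstar) (z k w - xstar).
pose Q := block_mx A 0 0 (mu *: Gi).
have XE u v : X *m col_mx u v = (1 + tau)^-1 *: u + (tau / (1 + tau)) *: v.
  by rewrite mul_row_col !mul_scalar_mx.
have ZE u v : Z *m col_mx u v = v by rewrite mul_row_col mul0mx add0r mul1mx.
have FE t u v (e := X *m col_mx u v) : F t *m col_mx u v =
    col_mx (e - gs_H A t *m (A *m e))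
      (v + tau *: (e - v) - (tau / mu) *: (gs_H A t *m (A *m e))).
  by rewrite mul_col_mx !(mulmxBl, mulmxDl) -!scalemxAl mulmxBl ZE -!mulmxA.
have bF : bddmx F.
  have bHAX : bddmx (fun t : borelMx R n p => gs_H A t *m (A *m X)).
    by apply: bddmxM (bddmx_cst _); exact: bddmx_gs_H.
  by apply: bddmx_col_mx; apply: bddmxD (bddmx_cst _) (bddmxN _) => //;
    exact: bddmxZ.
have s_init w : s 0 w = col_mx e0 e0 by rewrite /s y0 z0.
have s_rec i w : s i.+1 w = F (Sk i w) *m s i w.
  have xE : x i.+1 w - xstar = X *m s i w.
    rewrite XE xS !scalerBr addrACA -opprD -scalerDl.
    have -> : (1 + tau)^-1 + tau / (1 + tau) = 1 by field; rewrite gt_eqF.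
    by rewrite scale1r.
  have AE : A *m x i.+1 w - b = A *m (X *m s i w) by rewrite -xE mulmxBr Axb.
  rewrite FE /s yS zS AE -xE; congr col_mx; first by rewrite addrAC.
  rewrite addrAC; congr (_ - _); rewrite addrAC; congr (_ + _ *: _).
  by rewrite opprB addrA subrK.
have decay v : mean P (fun w => quadform Q (F (S w) *m v)) <= (1 - tau) * quadform Q v.
  rewrite -[v]vsubmxK; move: (usubmx v) (dsubmx v) => ey ez.
  under eq_mean do rewrite FE quadform_diag_block quadformZ.
  rewrite quadform_diag_block quadformZ.
  apply: (@one_step _ _ _ P n A Gi (fun w => gs_H A (S w)) mu (gs_nu A P S)) => //.
  - exact: bddmx_gs_H_sample.
  - exact: psd_inv_G.
  - by move=> w; exact: trmx_gs_H.
  - by move=> w; exact: gs_HAH.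
  - exact: mul_inv_G.
  - exact: mu_inv_G_le.
  - exact: mean_HGiH_le.
  - exact: tau_nu.
  rewrite XE scalerDr !scalerA mulfV ?gt_eqF// scale1r mulrCA mulfV ?mulr1//.
  by rewrite gt_eqF.
have tau1' : 0 <= 1 - tau by rewrite subr_ge0.
have Vk := lyapunov_decay Slaw Sindep bF s_init s_rec tau1' decay k.
have bys : bddmx (fun w => y k w - xstar).
  have -> : (fun w => y k w - xstar) = (fun w => usubmx (s k w)).
    by apply/funext => w; rewrite col_mxKu.
  by move=> i j; under eq_fun do rewrite mxE; exact: (bddmx_state bF s_init s_rec).
have byA := bddmeas_quadform A bys.
rewrite expectation_mean; last first.
  by apply: bddmeas_sqrt => // w; exact: (proj2 psdA).
rewrite lee_fin; apply: mean_le_of_sqr.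
- by apply: bddmeas_sqrt => // w; exact: (proj2 psdA).
- by rewrite !mulr_ge0 ?sqrtr_ge0 ?powR_ge0.
under eq_mean do rewrite sqr_sqrtr ?(proj2 psdA)//.
have -> : (Num.sqrt 2 * (1 - tau) `^ (k%:R / 2) * norm_mx A e0) ^+ 2 =
    (1 - tau) ^+ k * (2 * quadform A e0).
  rewrite !exprMn !sqr_sqrtr ?(proj2 psdA)//.
  rewrite -powR_mulrn ?powR_ge0// -powRrM divfK ?pnatr_eq0// powR_mulrn//.
  by ring.
have Q0 : quadform Q (col_mx e0 e0) <= 2 * quadform A e0.
  rewrite quadform_diag_block quadformZ mulr_natl mulr2n lerD2l.
  exact: (mu_inv_G_le pA mu0).
apply: (le_trans (le_trans _ Vk)); last by rewrite ler_wpM2l// exprn_ge0.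
apply: le_mean => //; first exact/bddmeas_quadform/(bddmx_state bF s_init s_rec).
move=> w; rewrite quadform_diag_block quadformZ lerDl mulr_ge0 ?(ltW mu0)//.
exact: (proj2 (psd_inv_G pA mu0)).
Qed.
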